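(* Let $k$ be a field, let $H$ be a quasi-bialgebra over $k$, and let $M$ be a finite dimensional right-left Yetter-Drinfeld module over $H$. Equip $M^*=\mathrm{Hom}_k(M,k)$ with the left $H$-action $(h\cdot m^* )(m)=m^*(m\cdot h)$ and with the $k$-linear map $M^*\to M^*\otimes H$, $m^*\mapsto\sum m^*_{(0)}\otimes m^*_{(1)}$, determined by $$\sum m^*_{(0)}(m)\,m^*_{(1)}=\sum m^*(m_{(0)})\,m_{(-1)}\quad\text{for all } m\in M .$$ Then: (i) $M^*\in{}_H\mathcal{YD}^H$, i.e. $M^*$ is a left-right Yetter-Drinfeld module over $H$; (ii) $R_{M^*}=R_M^*$, where $R_M:M\otimes M\to M\otimes M$, $R_M(m\otimes n)=\sum m\cdot n_{(-1)}\otimes n_{(0)}$, $R_{M^*}:M^*\otimes M^*\to M^*\otimes M^*$, $R_{M^*}(m^*\otimes n^* )=\sum n^*_{(1)}\cdot m^*\otimes n^*_{(0)}$, and $R_M^*$ is the transpose of $R_M$ under the identification $(M\otimes M)^*=M^*\otimes M^*$, $(m^*\otimes n^* )(m\otimes n)=m^*(m)n^*(n)$.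
   Context: All tensor products are over the field $k$. A quasi-bialgebra is $(H,\Delta,\varepsilon,\Phi)$ where $H$ is an associative unital $k$-algebra, $\Phi\in H\otimes H\otimes H$ is invertible, and $\Delta:H\to H\otimes H$, $\varepsilon:H\to k$ are algebra maps such that, for all $h\in H$: $(id\otimes\Delta)(\Delta(h))=\Phi\,(\Delta\otimes id)(\Delta(h))\,\Phi^{-1}$; $(id\otimes\varepsilon)(\Delta(h))=h=(\varepsilon\otimes id)(\Delta(h))$; $(1\otimes\Phi)(id\otimes\Delta\otimes id)(\Phi)(\Phi\otimes 1)=(id\otimes id\otimes\Delta)(\Phi)(\Delta\otimes id\otimes id)(\Phi)$; $(id\otimes\varepsilon\otimes id)(\Phi)=1\otimes 1\otimes 1$. Notation: $\Delta(h)=\sum h_1\otimes h_2$; $\Phi^{-1}=\sum x^1\otimes x^2\otimes x^3=\sum y^1\otimes y^2\otimes y^3$ (different letters denote independent copies). A right-left Yetter-Drinfeld module (object of ${}^H\mathcal{YD}_H$) is a right $H$-module $M$ (action $m\cdot h$) with a $k$-linear map $M\to H\otimes M$, $m\mapsto\sum m_{(-1)}\otimes m_{(0)}$, such that for all $m\in M$, $h\in H$: $$\sum m_{(-1)}x^1\otimes x^3(m_{(0)}\cdot x^2)_{(-1)}\otimes (m_{(0)}\cdot x^2)_{(0)}=\sum y^2(m\cdot y^1)_{(-1)_1}x^1\otimes y^3(m\cdot y^1)_{(-1)_2}x^2\otimes (m\cdot y^1)_{(0)}\cdot x^3,$$ $$\sum \varepsilon (m_{(-1)})m_{(0)}=m,\qquad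 \sum m_{(-1)}h_1\otimes m_{(0)}\cdot h_2=\sum h_2(m\cdot h_1)_{(-1)}\otimes (m\cdot h_1)_{(0)},$$ where $\Delta(m_{(-1)})=\sum m_{(-1)_1}\otimes m_{(-1)_2}$. A left-right Yetter-Drinfeld module (object of ${}_H\mathcal{YD}^H$) is a left $H$-module $N$ with a $k$-linear map $N\to N\otimes H$, $n\mapsto\sum n_{(0)}\otimes n_{(1)}$, such that for all $n\in N$, $h\in H$: $$\sum (x^2\cdot n_{(0)})_{(0)}\otimes (x^2\cdot n_{(0)})_{(1)}x^1\otimes x^3n_{(1)}=\sum x^1\cdot (y^3\cdot n)_{(0)}\otimes x^2(y^3\cdot n)_{(1)_1}y^1\otimes x^3(y^3\cdot n)_{(1)_2}y^2,$$ $$\sum \varepsilon (n_{(1)})n_{(0)}=n,\qquad \sum h_1\cdot n_{(0)}\otimes h_2n_{(1)}=\sum (h_2\cdot n)_{(0)}\otimes (h_2\cdot n)_{(1)}h_1 .$$ *)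

(* Defs.v *)
From HB Require Import structures.
From mathcomp Require Import all_boot all_order all_algebra.
From mathcomp Require Import boolp classical_sets.

Set Implicit Arguments.
Unset Strict Implicit.
Unset Printing Implicit Defensive.

Import GRing.Theory.
Local Open Scope ring_scope.
Local Open Scope quotient_scope.

Definition bilin (k : fieldType) (U V W : lmodType k) (f : U -> V -> W) : Prop :=
  (forall v, linear (f^~ v)) /\ (forall u, linear (f u)).

(* The tensor product over k by generators and relations: a list of pairs
   [:: (u1, v1); ...; (un, vn)] stands for u1 (x) v1 + ... + un (x) vn. *)

Section Tensor.
Variables (k : fieldType) (U V : lmodType k).

Inductive tensor_rel : seq (U * V) -> seq (U * V) -> Prop :=
| tensor_rel_refl s : tensor_rel s s
| tensor_rel_sym s t : tensor_rel s t -> tensor_rel t s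
| tensor_rel_trans t s r : tensor_rel s t -> tensor_rel t r -> tensor_rel s r
| tensor_rel_cat s1 s2 t1 t2 :
    tensor_rel s1 t1 -> tensor_rel s2 t2 -> tensor_rel (s1 ++ s2) (t1 ++ t2)
| tensor_rel_catC s t : tensor_rel (s ++ t) (t ++ s)
| tensor_rel_addl u u' v :
    tensor_rel [:: (u + u', v)] [:: (u, v); (u', v)]
| tensor_rel_addr u v v' :
    tensor_rel [:: (u, v + v')] [:: (u, v); (u, v')]
| tensor_rel_scale a u v : tensor_rel [:: (a *: u, v)] [:: (u, a *: v)]
| tensor_rel_zero v : tensor_rel [:: (0, v)] [::].

Definition tensor_relb : rel (seq (U * V)) := fun s t => `[< tensor_rel s t >].

Lemma tensor_relb_refl : reflexive tensor_relb.
Proof. by move=> s; apply/asboolP; apply: tensor_rel_refl. Qed.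

Lemma tensor_relb_sym : symmetric tensor_relb.
Proof. by move=> s t; apply/asboolP/asboolP; apply: tensor_rel_sym. Qed.

Lemma tensor_relb_trans : transitive tensor_relb.
Proof.
move=> t s r /asboolP st /asboolP tr; apply/asboolP.
exact: tensor_rel_trans st tr.
Qed.

Canonical tensor_equiv :=
  EquivRel tensor_relb tensor_relb_refl tensor_relb_sym tensor_relb_trans.

Definition tensor : Type := {eq_quot tensor_equiv}.

HB.instance Definition _ := Choice.on tensor.
HB.instance Definition _ := EqQuotient.on tensor.

Definition pure (u : U) (v : V) : tensor := \pi_tensor [:: (u, v)].

Lemma tensor_piP s t : tensor_rel s t <-> \pi_tensor s = \pi_tensor t.
Proof.
split=> [st|]; first by apply/eqmodP/asboolP.
by move/eqmodP => /asboolP.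
Qed.

Lemma tensorW (P : tensor -> Prop) : (forall s, P (\pi_tensor s)) -> forall x, P x.
Proof. by move=> Pp x; rewrite -[x]reprK. Qed.

Lemma tensor_repr_pi s : tensor_rel (repr (\pi_tensor s)) s.
Proof. by apply/tensor_piP; rewrite reprK. Qed.

Let scl (a : k) (s : seq (U * V)) := [seq (a *: p.1, p.2) | p <- s].

Lemma tensor_rel_scl a s t : tensor_rel s t -> tensor_rel (scl a s) (scl a t).
Proof.
elim=> {s t} [s|s t _|t s r _ + _|s1 s2 t1 t2 _ + _|s t|u u' v|u v v'|b u v|v] /=.
- exact: tensor_rel_refl.
- exact: tensor_rel_sym.
- exact: tensor_rel_trans.
- by move=> h1 h2; rewrite /scl !map_cat; apply: tensor_rel_cat.
- by rewrite /scl !map_cat; apply: tensor_rel_catC.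
- by rewrite scalerDr; apply: tensor_rel_addl.
- exact: tensor_rel_addr.
- by rewrite scalerA mulrC -scalerA; apply: tensor_rel_scale.
- by rewrite scaler0; apply: tensor_rel_zero.
Qed.

Definition tensor_add (x y : tensor) : tensor := \pi_tensor (repr x ++ repr y).
Definition tensor_scale (a : k) (x : tensor) : tensor :=
  \pi_tensor [seq (a *: p.1, p.2) | p <- repr x].
Definition tensor_zero : tensor := \pi_tensor [::].

Lemma tensor_add_pi s t :
  tensor_add (\pi_tensor s) (\pi_tensor t) = \pi_tensor (s ++ t).
Proof. by apply/tensor_piP/tensor_rel_cat; apply: tensor_repr_pi. Qed.

Lemma tensor_scale_pi a s : tensor_scale a (\pi_tensor s) = \pi_tensor (scl a s).
Proof. by apply/tensor_piP/tensor_rel_scl; apply: tensor_repr_pi. Qed.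

Lemma tensor_addA : associative tensor_add.
Proof.
move=> x y z; elim/tensorW: x => x; elim/tensorW: y => y; elim/tensorW: z => z.
by rewrite !tensor_add_pi catA.
Qed.

Lemma tensor_addC : commutative tensor_add.
Proof.
move=> x y; elim/tensorW: x => x; elim/tensorW: y => y; rewrite !tensor_add_pi.
exact/tensor_piP/tensor_rel_catC.
Qed.

Lemma tensor_add0 : left_id tensor_zero tensor_add.
Proof. by move=> x; elim/tensorW: x => x; rewrite tensor_add_pi. Qed.

Lemma tensor_rel_sclDl a b s : tensor_rel (scl (a + b) s) (scl a s ++ scl b s).
Proof.
elim: s => [|[u v] s IH] /=; first exact: tensor_rel_refl.
rewrite scalerDl -cat1s -[_ :: scl a s ++ _]cat1s.
apply: tensor_rel_trans (tensor_rel_cat (tensor_rel_addl _ _ _) IH) _.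
rewrite -[[:: _; _]]cat1s -!catA; apply: tensor_rel_cat.
  exact: tensor_rel_refl.
rewrite -[(_, _) :: scl b s]cat1s !catA; apply: tensor_rel_cat.
  exact: tensor_rel_catC.
exact: tensor_rel_refl.
Qed.

Lemma tensor_rel_scl0 s : tensor_rel (scl 0 s) [::].
Proof.
elim: s => [|[u v] s IH] /=; first exact: tensor_rel_refl.
by rewrite scale0r -cat1s -[[::]]cat0s; apply: tensor_rel_cat => //;
  apply: tensor_rel_zero.
Qed.

Lemma tensor_scaleDl x : {morph tensor_scale^~ x : a b / a + b >-> tensor_add a b}.
Proof.
move=> a b; elim/tensorW: x => s; rewrite !tensor_scale_pi tensor_add_pi.
exact/tensor_piP/tensor_rel_sclDl.
Qed.

Lemma tensor_scale1 : left_id 1 tensor_scale.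
Proof.
move=> x; elim/tensorW: x => s; rewrite tensor_scale_pi /scl.
by under eq_map do rewrite scale1r -surjective_pairing; rewrite map_id.
Qed.

Definition tensor_opp : tensor -> tensor := tensor_scale (-1).

Lemma tensor_addN : left_inverse tensor_zero tensor_opp tensor_add.
Proof.
move=> x; rewrite /tensor_opp -{2}[x]tensor_scale1 -tensor_scaleDl addNr.
by elim/tensorW: x => s; rewrite tensor_scale_pi; apply/tensor_piP/tensor_rel_scl0.
Qed.

HB.instance Definition _ :=
  GRing.isZmodule.Build tensor tensor_addA tensor_addC tensor_add0 tensor_addN.

Lemma tensor_scaleA a b x :
  tensor_scale a (tensor_scale b x) = tensor_scale (a * b) x.
Proof.
elim/tensorW: x => s; rewrite !tensor_scale_pi /scl -map_comp.
by congr \pi_tensor; apply: eq_map => p /=; rewrite scalerA.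
Qed.

Lemma tensor_scaleDr : right_distributive tensor_scale +%R.
Proof.
move=> a x y; elim/tensorW: x => x; elim/tensorW: y => y.
rewrite -[RHS]/(tensor_add _ _) -[\pi_tensor x + _]/(tensor_add _ _).
by rewrite !(tensor_scale_pi, tensor_add_pi) /scl map_cat.
Qed.

HB.instance Definition _ := GRing.Zmodule_isLmodule.Build k tensor
  tensor_scaleA tensor_scale1 tensor_scaleDr tensor_scaleDl.

Lemma pi_sum s : \pi_tensor s = \sum_(p <- s) pure p.1 p.2.
Proof.
elim: s => [|[u v] s IH]; first by rewrite big_nil.
by rewrite big_cons -IH -[LHS](tensor_add_pi [:: (u, v)] s).
Qed.

Lemma tensorE (t : tensor) : t = \sum_(p <- repr t) pure p.1 p.2.
Proof. by rewrite -pi_sum reprK. Qed.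

Lemma pure_bilin : bilin pure.
Proof.
have sc a u v : pure (a *: u) v = a *: pure u v.
  by rewrite [RHS]tensor_scale_pi.
split=> [v a u u'|u a v v'].
  rewrite -sc; transitivity (\pi_tensor [:: (a *: u, v); (u', v)]).
    exact/tensor_piP/tensor_rel_addl.
  by rewrite pi_sum big_cons big_seq1.
rewrite -sc; transitivity (\pi_tensor [:: (u, a *: v); (u, v')]).
  exact/tensor_piP/tensor_rel_addr.
rewrite pi_sum big_cons big_seq1; congr (_ + _).
by apply/esym/tensor_piP/tensor_rel_scale.
Qed.

(* Sweedler summation: the sum of f u v over the terms of a presentation of t.
   It is independent of the presentation when f is bilinear (tsum_pure and
   tsum_linear below). *)
Definition tsum (W : nmodType) (t : tensor) (f : U -> V -> W) : W :=
  \sum_(p <- repr t) f p.1 p.2.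

Lemma tensor_rel_sum (W : lmodType k) (f : U -> V -> W) s t :
  bilin f -> tensor_rel s t ->
  \sum_(p <- s) f p.1 p.2 = \sum_(p <- t) f p.1 p.2.
Proof.
move=> [fl fr]; pose L v : {linear U -> W} :=
  HB.pack (f^~ v) (GRing.isLinear.Build _ _ _ _ _ (fl v)).
pose R u : {linear V -> W} :=
  HB.pack (f u) (GRing.isLinear.Build _ _ _ _ _ (fr u)).
elim=> {s t} //= [t s r _ -> _ -> //|s1 s2 t1 t2 _ e1 _ e2|s t|u u' v|u v v'|a u v|v].
- by rewrite !big_cat e1 e2.
- by rewrite !big_cat /= addrC.
- by rewrite !big_cons !big_nil /= !addr0; apply: (raddfD (L v)).
- by rewrite !big_cons !big_nil /= !addr0; apply: (raddfD (R u)).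
- rewrite !big_seq1 /=.
  by rewrite -[LHS]/(L v (a *: u)) -[RHS]/(R u (a *: v)) !linearZ.
- by rewrite big_seq1 big_nil; apply: (raddf0 (L v)).
Qed.

Lemma tsum_pi (W : lmodType k) (f : U -> V -> W) s :
  bilin f -> tsum (\pi_tensor s) f = \sum_(p <- s) f p.1 p.2.
Proof. by move=> bf; apply: tensor_rel_sum => //; apply: tensor_repr_pi. Qed.

Lemma tsum_pure (W : lmodType k) (f : U -> V -> W) u v :
  bilin f -> tsum (pure u v) f = f u v.
Proof. by move=> bf; rewrite tsum_pi // big_seq1. Qed.

Lemma tsum_linear (W : lmodType k) (f : U -> V -> W) :
  bilin f -> linear (fun t => tsum t f).
Proof.
move=> bf a x y; elim/tensorW: x => s; elim/tensorW: y => t.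
have -> : a *: \pi_tensor s + \pi_tensor t = \pi_tensor (scl a s ++ t).
  by rewrite -tensor_add_pi -tensor_scale_pi.
rewrite !tsum_pi // big_cat /=; congr (_ + _).
rewrite big_map scaler_sumr; apply: eq_bigr => -[u v] _ /=.
have [fl _] := bf; pose L : {linear U -> W} :=
  HB.pack (f^~ v) (GRing.isLinear.Build _ _ _ _ _ (fl v)).
by rewrite -[LHS]/(L (a *: u)) linearZ.
Qed.

Lemma tensor_ext (W : lmodType k) (f g : tensor -> W) :
  linear f -> linear g -> (forall u v, f (pure u v) = g (pure u v)) -> f =1 g.
Proof.
move=> lf lg fg t.
pose F : {linear tensor -> W} :=
  HB.pack f (GRing.isLinear.Build _ _ _ _ _ lf).
pose G : {linear tensor -> W} :=
  HB.pack g (GRing.isLinear.Build _ _ _ _ _ lg).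
rewrite -[f t]/(F t) -[g t]/(G t) [t]tensorE !linear_sum.
by apply: eq_bigr => p _; apply: fg.
Qed.

End Tensor.

Notation "U \ox V" := (tensor U%type V%type)
  (at level 40, left associativity) : type_scope.
Notation "u \ox v" := (pure u v)
  (at level 40, left associativity) : ring_scope.

Definition tsum3 (k : fieldType) (U V W : lmodType k) (X : nmodType)
    (t : U \ox V \ox W) (f : U -> V -> W -> X) : X :=
  tsum t (fun uv w => tsum uv (fun u v => f u v w)).

Notation "\sw_ ( a , b <- t ) F" := (tsum t (fun a b => F))
  (at level 41, F at level 41, a name, b name,
   format "\sw_ ( a ,  b  <-  t )  F") : ring_scope.
Notation "\sw_ ( a , b , c <- t ) F" := (tsum3 t (fun a b c => F))
  (at level 41, F at level 41, a name, b name, c name,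
   format "\sw_ ( a ,  b ,  c  <-  t )  F") : ring_scope.

Section TensorTheory.
Variables (k : fieldType).
Implicit Types U V W X : lmodType k.

Lemma linear_comp U V W (f : V -> W) (g : U -> V) :
  linear f -> linear g -> linear (fun x => f (g x)).
Proof. by move=> lf lg a x y; rewrite lg lf. Qed.

Lemma pure_linl U V (v : V) : linear (fun u : U => u \ox v).
Proof. by have [+ _] := @pure_bilin k U V; apply. Qed.

Lemma pure_linr U V (u : U) : linear (fun v : V => u \ox v).
Proof. by have [_ +] := @pure_bilin k U V; apply. Qed.

Lemma pure_linlE U V a (u u' : U) (v : V) :
  (a *: u + u') \ox v = a *: (u \ox v) + u' \ox v.
Proof. exact: pure_linl. Qed.

Lemma pure_linrE U V a (u : U) (v v' : V) :
  u \ox (a *: v + v') = a *: (u \ox v) + u \ox v'.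
Proof. exact: pure_linr. Qed.

Lemma linear_tsum U V W X (s : U \ox V) (f : X -> U -> V -> W) :
  (forall u v, linear (fun x => f x u v)) -> linear (fun x => tsum s (f x)).
Proof.
move=> lf a x y; rewrite /tsum scaler_sumr -big_split /=.
by apply: eq_bigr => p _; apply: lf.
Qed.

Lemma eq_tsum U V (W : nmodType) (s : U \ox V) (f g : U -> V -> W) :
  (forall u v, f u v = g u v) -> tsum s f = tsum s g.
Proof. by move=> fg; apply: eq_bigr => p _; apply: fg. Qed.

Lemma pure_suml U V I (r : seq I) (F : I -> U) (v : V) :
  (\sum_(i <- r) F i) \ox v = \sum_(i <- r) F i \ox v.
Proof.
pose L : {linear U -> (U \ox V)%type} :=
  HB.pack (fun u : U => u \ox v) (GRing.isLinear.Build _ _ _ _ _ (pure_linl v)).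
exact: (linear_sum L).
Qed.

Lemma pure_sumr U V I (r : seq I) (F : I -> V) (u : U) :
  u \ox (\sum_(i <- r) F i) = \sum_(i <- r) u \ox F i.
Proof.
pose L : {linear V -> (U \ox V)%type} :=
  HB.pack (fun v : V => u \ox v) (GRing.isLinear.Build _ _ _ _ _ (pure_linr u)).
exact: (linear_sum L).
Qed.

Lemma pureZl U V a (u : U) (v : V) : (a *: u) \ox v = a *: (u \ox v).
Proof.
pose L : {linear U -> (U \ox V)%type} :=
  HB.pack (fun u : U => u \ox v) (GRing.isLinear.Build _ _ _ _ _ (pure_linl v)).
by rewrite -[LHS]/(L _) linearZ.
Qed.

Lemma pureZr U V a (u : U) (v : V) : u \ox (a *: v) = a *: (u \ox v).
Proof.
pose L : {linear V -> (U \ox V)%type} :=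
  HB.pack (fun v : V => u \ox v) (GRing.isLinear.Build _ _ _ _ _ (pure_linr u)).
by rewrite -[LHS]/(L _) linearZ.
Qed.

End TensorTheory.

Section LinearForm.
Variables (k : fieldType) (V : lmodType k) (e : V).
Hypothesis e0 : e != 0.
Local Open Scope classical_set_scope.

Lemma exists_linear_form : exists f : V -> k^o, linear f /\ f e = 1.
Proof.
pose P (W : set V) := (forall a x y, W x -> W y -> W (a *: x + y)) /\ ~ W e.
have [|W [[Wlin We] Wmax]] := @Zorn_bigcup V P.
  move=> F FP Ftot; split=> [a x y [A FA Ax] [B FB By]|[A FA Ae]]; last first.
    by have [_] := FP _ FA; apply.
  have [AB|BA] := Ftot _ _ FA FB.
    by exists B => //; have [+ _] := FP _ FB; apply => //; apply: AB.
  by exists A => //; have [+ _] := FP _ FA; apply => //; apply: BA.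
have W0 : W 0.
  apply: contrapT => nW0.
  have Wn x : ~ W x.
    by move=> Wx; apply: nW0; rewrite -(addNr x) -scaleN1r; apply: Wlin.
  apply: (Wmax [set 0]).
    by split=> [x /Wn //|sub]; apply: nW0; apply: sub.
  split=> [a x y -> ->|/= /eqP ee]; first by rewrite scaler0 addr0.
  by move: e0; rewrite ee.
have WZ a x : W x -> W (a *: x) by move=> Wx; rewrite -[_ *: x]addr0; apply: Wlin.
have WD x y : W x -> W y -> W (x + y).
  by move=> Wx Wy; rewrite -[x]scale1r; apply: Wlin.
have WB x y : W x -> W y -> W (x - y).
  by move=> Wx Wy; apply: WD => //; rewrite -scaleN1r; apply: WZ.
have ex x : exists c : k, W (x - c *: e).
  have [Wx|nWx] := pselect (W x); first by exists 0; rewrite scale0r subr0.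
  apply: contrapT => nc.
  apply: (Wmax [set y | exists a : k, W (y - a *: x)]).
    split=> [y Wy|sub]; first by exists 0; rewrite scale0r subr0.
    by apply: nWx; apply: sub; exists 1; rewrite scale1r subrr.
  split=> [a y z [b Wy] [c Wz]|[a Wea]].
    exists (a * b + c).
    have -> : a *: y + z - (a * b + c) *: x = a *: (y - b *: x) + (z - c *: x).
      by rewrite scalerBr scalerDl scalerA opprD addrACA.
    exact: Wlin.
  have a0 : a != 0.
    by apply/eqP => a0; apply: We; rewrite a0 scale0r subr0 in Wea.
  apply: nc; exists a^-1.
  have -> : x - a^-1 *: e = (- a^-1) *: (e - a *: x).
    by rewrite scalerBr !scaleNr scalerA mulVf // scale1r opprK addrC.
  exact: WZ.
have unique x a b : W (x - a *: e) -> W (x - b *: e) -> a = b.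
  move=> Wa Wb; apply/eqP; rewrite eq_sym -subr_eq0; apply/negPn/negP => ab.
  apply: We; rewrite -[e]scale1r -(mulVf ab) -scalerA; apply: WZ.
  have -> : (b - a) *: e = (x - a *: e) - (x - b *: e).
    by rewrite opprB [RHS]addrC addrA subrK scalerBl.
  exact: WB.
pose f x : k^o := sval (cid (ex x)).
have fP x : W (x - f x *: e) by rewrite /f; case: cid.
exists f; split; last first.
  by apply: (unique e) (fP e) _; rewrite scale1r subrr.
move=> a x y; apply: (unique _ _ _ (fP _)).
have -> : a *: x + y - (a *: f x + f y : k) *: e
    = a *: (x - f x *: e) + (y - f y *: e).
  by rewrite scalerBr scalerDl -scalerA opprD addrACA.
exact: Wlin.
Qed.

End LinearForm.

Section TensorAlgebra.
Variables (k : fieldType) (A B : algType k).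
Implicit Types x y z : A \ox B.

Definition tensor_mul x y : A \ox B :=
  \sw_(a, b <- x) \sw_(c, d <- y) ((a * c) \ox (b * d)).

Lemma tensor_mul_bilin1 (a : A) (b : B) : bilin (fun c d => (a * c) \ox (b * d)).
Proof.
split=> [d|c] l u v.
  by rewrite mulrDr -scalerAr pure_linlE.
by rewrite mulrDr -scalerAr pure_linrE.
Qed.

Lemma tensor_mul_bilin2 y :
  bilin (fun a b => \sw_(c, d <- y) ((a * c) \ox (b * d))).
Proof.
split=> [b|a]; apply: linear_tsum => c d l u v.
  by rewrite mulrDl -scalerAl pure_linlE.
by rewrite mulrDl -scalerAl pure_linrE.
Qed.

Lemma tensor_mul_bilin : bilin tensor_mul.
Proof.
split=> [y|x]; first exact: tsum_linear (tensor_mul_bilin2 y).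
by apply: linear_tsum => a b; apply: tsum_linear (tensor_mul_bilin1 a b).
Qed.

Lemma tensor_mul_linl y : linear (tensor_mul^~ y).
Proof. by have [+ _] := tensor_mul_bilin; apply. Qed.

Lemma tensor_mul_linr x : linear (tensor_mul x).
Proof. by have [_ +] := tensor_mul_bilin; apply. Qed.

Lemma tensor_mul_pure (a c : A) (b d : B) :
  tensor_mul (a \ox b) (c \ox d) = (a * c) \ox (b * d).
Proof.
rewrite /tensor_mul tsum_pure; last exact: tensor_mul_bilin2.
by rewrite tsum_pure //; apply: tensor_mul_bilin1.
Qed.

Lemma tensor_mulA : associative tensor_mul.
Proof.
move=> x y z; move: x; apply: tensor_ext => [||a b].
- exact: tensor_mul_linl.
- exact: (@linear_comp _ _ _ _ (tensor_mul^~ z) _ (tensor_mul_linl z)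
    (tensor_mul_linl y)).
move: y; apply: tensor_ext => [||c d].
- exact: (@linear_comp _ _ _ _ (tensor_mul _) _ (tensor_mul_linr _)
    (tensor_mul_linl z)).
- exact: (@linear_comp _ _ _ _ (tensor_mul^~ z) _ (tensor_mul_linl z)
    (tensor_mul_linr _)).
move: z; apply: tensor_ext => [||e f].
- exact: (@linear_comp _ _ _ _ (tensor_mul _) _ (tensor_mul_linr _)
    (tensor_mul_linr _)).
- exact: tensor_mul_linr.
by rewrite !tensor_mul_pure !mulrA.
Qed.

Lemma linear_id (V : lmodType k) : linear (fun v : V => v).
Proof. by []. Qed.

Lemma tensor_mul1 : left_id (1 \ox 1) tensor_mul.
Proof.
apply: tensor_ext => [||a b]; [exact: tensor_mul_linr|exact: linear_id|].
by rewrite tensor_mul_pure !mul1r.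
Qed.

Lemma tensor_1mul : right_id (1 \ox 1) tensor_mul.
Proof.
apply: tensor_ext => [||a b]; [exact: tensor_mul_linl|exact: linear_id|].
by rewrite tensor_mul_pure !mulr1.
Qed.

Lemma tensor_mulDl : left_distributive tensor_mul +%R.
Proof. by move=> x y z; rewrite -[x in LHS]scale1r tensor_mul_linl scale1r. Qed.

Lemma tensor_mulDr : right_distributive tensor_mul +%R.
Proof. by move=> x y z; rewrite -[y in LHS]scale1r tensor_mul_linr scale1r. Qed.

Lemma tensor_1_neq0 : (1 : A) \ox (1 : B) != 0.
Proof.
have [f [lf f1]] := exists_linear_form (oner_neq0 A).
have [g [lg g1]] := exists_linear_form (oner_neq0 B).
have bfg : bilin (fun a b => f a * g b : k^o).
  split=> [v l x y|u l x y] /=.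
    by rewrite lf mulrDl /= -mulrA.
  by rewrite lg mulrDr /= /GRing.scale /= mulrCA.
apply/eqP => e0; have := tsum_linear bfg 0 0 (1 \ox 1).
have := tsum_pure 1 1 bfg; rewrite f1 g1 mulr1 e0 => e1.
rewrite scale0r add0r scale0r add0r e1.
have := tsum_linear bfg 1 0 0; rewrite scaler0 addr0 e1 scale1r => /eqP.
by rewrite -subr_eq0 opprD addrA subrr sub0r oppr_eq0 oner_eq0.
Qed.

HB.instance Definition _ := GRing.Zmodule_isNzRing.Build (A \ox B)%type
  tensor_mulA tensor_mul1 tensor_1mul tensor_mulDl tensor_mulDr tensor_1_neq0.

Lemma tensor_scalerAl (a : k) x y : a *: (x * y) = a *: x * y.
Proof.
by rewrite -[a *: x]addr0 [RHS](tensor_mul_linl y a x 0) -[tensor_mul 0 y]/(0 * y) mul0r addr0.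
Qed.

HB.instance Definition _ :=
  GRing.Lmodule_isLalgebra.Build k (A \ox B)%type tensor_scalerAl.

Lemma tensor_scalerAr (a : k) x y : a *: (x * y) = x * (a *: y).
Proof.
by rewrite -[a *: y]addr0 [RHS](tensor_mul_linr x a y 0) -[tensor_mul x 0]/(x * 0) mulr0 addr0.
Qed.

HB.instance Definition _ :=
  GRing.Lalgebra_isAlgebra.Build k (A \ox B)%type tensor_scalerAr.

End TensorAlgebra.
Definition tmap (k : fieldType) (U U' V V' : lmodType k)
    (f : U -> U') (g : V -> V') (t : U \ox V) : U' \ox V' :=
  \sw_(u, v <- t) (f u \ox g v).

Definition tassoc (k : fieldType) (U V W : lmodType k)
    (t : U \ox (V \ox W)) : U \ox V \ox W :=
  \sw_(u, s <- t) \sw_(v, w <- s) (u \ox v \ox w).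

(* Iterated tensor products are left-associated, so id (x) Delta is followed by
   the identification tassoc. *)
Record quasi_bialgebra (k : fieldType) (H : algType k) := QuasiBialgebra {
  Delta : {lrmorphism H -> H \ox H};
  eps : {lrmorphism H -> k^o};
  Phi : H \ox H \ox H;
  PhiV : H \ox H \ox H;
  Phi_PhiV : Phi * PhiV = 1;
  PhiV_Phi : PhiV * Phi = 1;
  Delta_coassoc : forall h : H,
    tassoc (tmap idfun Delta (Delta h)) =
      Phi * tmap Delta idfun (Delta h) * PhiV;
  Delta_counitr : forall h : H, \sw_(h1, h2 <- Delta h) (eps h2 *: h1) = h;
  Delta_counitl : forall h : H, \sw_(h1, h2 <- Delta h) (eps h1 *: h2) = h;
  Phi_pentagon :
    (\sw_(X1, X2, X3 <- Phi) (1 \ox X1 \ox X2 \ox X3))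
      * tmap (fun t => tassoc (tmap idfun Delta t)) idfun Phi
      * (Phi \ox 1)
    = tassoc (tmap idfun Delta Phi) * tmap (tmap Delta idfun) idfun Phi;
  Phi_counit :
    tmap (tmap idfun eps) idfun Phi = 1 \ox 1 \ox 1 :> H \ox k^o \ox H
}.

Section YetterDrinfeld.
Variables (k : fieldType) (H : algType k) (Q : quasi_bialgebra H).
Variable M : lmodType k.

Record is_right_module (act : M -> H -> M) : Prop := IsRightModule {
  ract_bilin : bilin act;
  ract1 : forall m, act m 1 = m;
  ractM : forall m g h, act m (g * h) = act (act m g) h
}.

Record is_left_module (act : H -> M -> M) : Prop := IsLeftModule {
  lact_bilin : bilin act;
  lact1 : forall m, act 1 m = m;
  lactM : forall g h m, act (g * h) m = act g (act h m)
}.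

Record is_rl_YD (act : M -> H -> M) (coact : {linear M -> (H \ox M)%type}) : Prop :=
  IsRLYD {
  rl_YD_module : is_right_module act;
  rl_YD_coassoc : forall m,
    \sw_(x1, x2, x3 <- PhiV Q)
    \sw_(a, m0 <- coact m)
    \sw_(b, n0 <- coact (act m0 x2))
      ((a * x1) \ox (x3 * b) \ox n0)
    =
    \sw_(x1, x2, x3 <- PhiV Q)
    \sw_(y1, y2, y3 <- PhiV Q)
    \sw_(a, n0 <- coact (act m y1))
    \sw_(a1, a2 <- Delta Q a)
      ((y2 * a1 * x1) \ox (y3 * a2 * x2) \ox act n0 x3);
  rl_YD_counit : forall m, \sw_(a, m0 <- coact m) (eps Q a *: m0) = m;
  rl_YD_compat : forall m h,
    \sw_(h1, h2 <- Delta Q h) \sw_(a, m0 <- coact m)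
      ((a * h1) \ox act m0 h2)
    =
    \sw_(h1, h2 <- Delta Q h) \sw_(a, n0 <- coact (act m h1))
      ((h2 * a) \ox n0)
}.

Record is_lr_YD (act : H -> M -> M) (coact : {linear M -> (M \ox H)%type}) : Prop :=
  IsLRYD {
  lr_YD_module : is_left_module act;
  lr_YD_coassoc : forall n,
    \sw_(x1, x2, x3 <- PhiV Q)
    \sw_(n0, a <- coact n)
    \sw_(p0, b <- coact (act x2 n0))
      (p0 \ox (b * x1) \ox (x3 * a))
    =
    \sw_(x1, x2, x3 <- PhiV Q)
    \sw_(y1, y2, y3 <- PhiV Q)
    \sw_(p0, a <- coact (act y3 n))
    \sw_(a1, a2 <- Delta Q a)
      (act x1 p0 \ox (x2 * a1 * y1) \ox (x3 * a2 * y2));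
  lr_YD_counit : forall n, \sw_(n0, a <- coact n) (eps Q a *: n0) = n;
  lr_YD_compat : forall n h,
    \sw_(h1, h2 <- Delta Q h) \sw_(n0, a <- coact n)
      (act h1 n0 \ox (h2 * a))
    =
    \sw_(h1, h2 <- Delta Q h) \sw_(p0, a <- coact (act h2 n))
      (p0 \ox (a * h1))
}.

Definition rl_R (act : M -> H -> M) (coact : M -> H \ox M) (t : M \ox M) :
    M \ox M :=
  \sw_(m, n <- t) \sw_(a, n0 <- coact n) (act m a \ox n0).

Lemma rl_R_linear (act : M -> H -> M) (coact : {linear M -> (H \ox M)%type}) :
  bilin act -> linear (rl_R act coact).
Proof.
move=> [actl actr].
have bR : bilin (fun m n => \sw_(a, n0 <- coact n) (act m a \ox n0)).
  split=> [n|m] l x y.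
    rewrite /tsum scaler_sumr -big_split; apply: eq_bigr => p _ /=.
    by rewrite actl pure_linlE.
  have b : bilin (fun (a : H) (n0 : M) => act m a \ox n0).
    by split=> [n0|a] c u v; rewrite ?actr ?pure_linlE ?pure_linrE.
  by rewrite linearP; apply: (tsum_linear b).
exact: tsum_linear bR.
Qed.

Definition lr_R (act : H -> M -> M) (coact : M -> M \ox H) (t : M \ox M) :
    M \ox M :=
  \sw_(m, n <- t) \sw_(n0, a <- coact n) (act a m \ox n0).

End YetterDrinfeld.

Section Dual.
Variables (k : fieldType) (H : algType k) (M : vectType k).
Local Notation M' := 'Hom(M, k^o).

Definition dual_act (act : M -> H -> M) (h : H) (f : M') : M' :=
  linfun (fun m => f (act m h)).

Lemma dual_actE (act : M -> H -> M) h f m :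
  (forall h, linear (act^~ h)) -> dual_act act h f m = f (act m h).
Proof.
move=> la; have lfa : linear (fun m => f (act m h)).
  by move=> a x y; rewrite la linearP.
pose F : {linear M -> k^o} :=
  HB.pack (fun m => f (act m h)) (GRing.isLinear.Build _ _ _ _ _ lfa).
exact: (lfunE F).
Qed.

Definition vb (i : 'I_(\dim {:M})) : M := (vbasis {:M})`_i.
Definition cvb (i : 'I_(\dim {:M})) : M' := linfun (coord (vbasis {:M}) i : M -> k^o).

Lemma vbE m : m = \sum_i cvb i m *: vb i.
Proof.
rewrite [LHS](coord_vbasis (memvf m)); apply: eq_bigr => i _.
by rewrite /cvb lfunE.
Qed.

Lemma cvbE (f : M') : f = \sum_i f (vb i) *: cvb i.
Proof.
apply/lfunP => m; rewrite [in LHS](vbE m) linear_sum sum_lfunE.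
by apply: eq_bigr => i _; rewrite linearZ scale_lfunE /= /GRing.scale /= mulrC.
Qed.

Lemma eval_bilin (W : lmodType k) m : bilin (fun (f : M') (w : W) => f m *: w).
Proof.
split=> [w|f] a x y; first by rewrite add_lfunE scale_lfunE scalerDl scalerA.
by rewrite scalerDr !scalerA mulrC.
Qed.

Lemma linear_sum_fun (U W : lmodType k) I (r : seq I) (F : I -> U -> W) :
  (forall i, linear (F i)) -> linear (fun x => \sum_(i <- r) F i x).
Proof.
move=> lF a x y; rewrite scaler_sumr -big_split /=.
by apply: eq_bigr => i _; apply: lF.
Qed.

Lemma dual_tensorE (W : lmodType k) (t : M' \ox W) :
  t = \sum_i cvb i \ox \sw_(f, w <- t) (f (vb i) *: w).
Proof.
move: t; apply: (@tensor_ext k _ _ (M' \ox W)%type id) => [//||f w].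
  apply: linear_sum_fun => i a x y.
  by rewrite (tsum_linear (@eval_bilin W (vb i))) pure_linrE.
rewrite [f in LHS]cvbE.
rewrite pure_suml; apply: eq_bigr => i _; rewrite pureZl tsum_pure ?pureZr //.
exact: eval_bilin.
Qed.

Lemma dual_tensor_eq (W : lmodType k) (s t : M' \ox W) :
  (forall m, \sw_(f, w <- s) (f m *: w) = \sw_(f, w <- t) (f m *: w)) -> s = t.
Proof.
by move=> st; rewrite (dual_tensorE s) (dual_tensorE t);
  apply: eq_bigr => i _; rewrite st.
Qed.

Section Coaction.
Variable coact : {linear M -> (H \ox M)%type}.

Lemma coact_eval_bilin (f : M') : bilin (fun (a : H) (m : M) => f m *: a).
Proof.
split=> [m|a] l x y; first by rewrite scalerDr !scalerA mulrC.
by rewrite linearP scalerDl scalerA.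
Qed.

Lemma dual_coact_exists :
  {rho : {linear M' -> (M' \ox H)%type} | forall f m,
    \sw_(f0, a <- rho f) (f0 m *: a) = \sw_(a, m0 <- coact m) (f m0 *: a)}.
Proof.
pose rho (f : M') : (M' \ox H)%type :=
  \sum_i cvb i \ox \sw_(a, m0 <- coact (vb i)) (f m0 *: a).
have lrho : linear rho.
  apply: linear_sum_fun => i l f g; rewrite -pure_linrE; congr (_ \ox _).
  apply: (@linear_tsum k H M H _ (coact (vb i))
    (fun (f : M') a m => f m *: a)) => a m c x y.
  by rewrite add_lfunE scale_lfunE scalerDl scalerA.
pose L : {linear M' -> (M' \ox H)%type} :=
  HB.pack rho (GRing.isLinear.Build _ _ _ _ _ lrho).
exists L => f m; rewrite -[L f]/(rho f).
pose E : {linear (M' \ox H)%type -> H} :=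
  HB.pack (fun t : M' \ox H => \sw_(f0, a <- t) (f0 m *: a))
   (GRing.isLinear.Build _ _ _ _ _ (tsum_linear (eval_bilin H m))).
pose C : {linear (H \ox M)%type -> H} :=
  HB.pack (fun t : H \ox M => \sw_(a, m0 <- t) (f m0 *: a))
   (GRing.isLinear.Build _ _ _ _ _ (tsum_linear (coact_eval_bilin f))).
rewrite -[LHS]/(E _) -[RHS]/(C _) linear_sum [in RHS](vbE m) !linear_sum.
apply: eq_bigr => i _; rewrite !linearZ /=.
by rewrite tsum_pure //; apply: eval_bilin.
Qed.

(* The map f |-> sum f_(0) (x) f_(1) determined by
   sum f_(0)(m) f_(1) = sum f(m_(0)) m_(-1) for all m. *)
Definition dual_coact : {linear M' -> (M' \ox H)%type} :=
  sval dual_coact_exists.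

Lemma dual_coactP f m :
  \sw_(f0, a <- dual_coact f) (f0 m *: a) = \sw_(a, m0 <- coact m) (f m0 *: a).
Proof. exact: (svalP dual_coact_exists). Qed.

Lemma dual_coact_unique (rho : M' -> M' \ox H) :
  (forall f m,
    \sw_(f0, a <- rho f) (f0 m *: a) = \sw_(a, m0 <- coact m) (f m0 *: a)) ->
  rho =1 dual_coact.
Proof.
by move=> rhoP f; apply: dual_tensor_eq => m; rewrite rhoP dual_coactP.
Qed.

End Coaction.

(* The identification of M^* (x) M^* with (M (x) M)^*. *)
Definition dual_tensor (t : M' \ox M') (s : M \ox M) : k^o :=
  \sw_(f, g <- t) \sw_(m, n <- s) (f m * g n : k^o).

Definition dual_tensor_inv (phi : M \ox M -> k^o) : M' \ox M' :=
  \sum_i \sum_j (phi (vb i \ox vb j) : k) *: (cvb i \ox cvb j).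

Lemma dual_tensor_bilin1 (f g : M') : bilin (fun m n => f m * g n : k^o).
Proof.
split=> [n|m] l x y; first by rewrite linearP mulrDl -scalerAl.
by rewrite linearP mulrDr -scalerAr.
Qed.

Lemma dual_tensor_bilin2 s :
  bilin (fun f g : M' => \sw_(m, n <- s) (f m * g n : k^o)).
Proof.
split=> [g|f]; apply: linear_tsum => m n l x y.
  by rewrite add_lfunE scale_lfunE mulrDl -scalerAl.
by rewrite add_lfunE scale_lfunE mulrDr -scalerAr.
Qed.

Lemma dual_tensor_linearl s : linear (dual_tensor^~ s).
Proof. exact: tsum_linear (dual_tensor_bilin2 s). Qed.

Lemma dual_tensor_linear t : linear (dual_tensor t).
Proof.
by apply: linear_tsum => f g; apply: tsum_linear (dual_tensor_bilin1 f g).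
Qed.

Lemma dual_tensor_pure (f g : M') (m n : M) :
  dual_tensor (f \ox g) (m \ox n) = f m * g n.
Proof.
rewrite /dual_tensor tsum_pure; last exact: dual_tensor_bilin2.
by rewrite tsum_pure //; apply: dual_tensor_bilin1.
Qed.

Lemma dual_tensorK : cancel dual_tensor dual_tensor_inv.
Proof.
apply: tensor_ext => [|//|f g].
  apply: linear_sum_fun => i; apply: linear_sum_fun => j l x y.
  by rewrite dual_tensor_linearl scalerDl scalerA.
rewrite [f in RHS]cvbE [g in RHS]cvbE pure_suml; apply: eq_bigr => i _.
rewrite pure_sumr; apply: eq_bigr => j _.
by rewrite dual_tensor_pure pureZl pureZr scalerA.
Qed.

Lemma dual_tensor_invK phi :
  linear phi -> dual_tensor (dual_tensor_inv phi) =1 phi.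
Proof.
move=> lphi; pose L : {linear (M \ox M)%type -> k^o} :=
  HB.pack phi (GRing.isLinear.Build _ _ _ _ _ lphi).
apply: tensor_ext => [|//|m n]; first exact: dual_tensor_linear.
pose D : {linear (M' \ox M')%type -> k^o} :=
  HB.pack (dual_tensor^~ (m \ox n))
    (GRing.isLinear.Build _ _ _ _ _ (dual_tensor_linearl (m \ox n))).
rewrite [m in RHS]vbE [n in RHS]vbE pure_suml -[RHS]/(L _) -[LHS]/(D _).
rewrite !linear_sum; apply: eq_bigr => i _.
rewrite pure_sumr !linear_sum; apply: eq_bigr => j _.
rewrite pureZl pureZr !linearZ /= dual_tensor_pure.
by rewrite /GRing.scale /= mulrA mulrC.
Qed.

(* The transpose of F on (M (x) M)^*, transported to M^* (x) M^*. *)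
Definition transpose (F : M \ox M -> M \ox M) (t : M' \ox M') : M' \ox M' :=
  dual_tensor_inv (dual_tensor t \o F).

End Dual.

(* Main.v *)
From HB Require Import structures.
Require Import Defs.
From mathcomp Require Import all_boot all_order all_algebra.

(** Each axiom of a left-right Yetter-Drinfeld module on [M^*] is an identity in
[M^*], [M^* (x) H] or [M^* (x) H (x) H]. As [M] is finite dimensional, such an
identity may be tested by evaluating the [M^*]-leg at every [m]. The defining
property of the dual coaction moves the evaluation through the coaction, and
evaluating the axiom for [f] at [m] becomes the image under [f] of the
corresponding right-left axiom for [m], up to exchanging the names of the two
copies of the inverse associator. *)

Set Implicit Arguments.
Unset Strict Implicit.
Unset Printing Implicit Defensive.

Import GRing.Theory.
Local Open Scope ring_scope.

(** * Sweedler sums: passage of linear maps and exchange of summations *)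

Section SweedlerSums.
Variable k : fieldType.
Implicit Types U V W X Y : lmodType k.

(** A Sweedler sum is a finite sum over one fixed representative of [t], so a linear map passes
    through it whatever the summand is. *)
Lemma tsum_lin U V X Y (L : X -> Y) (t : U \ox V) (f : U -> V -> X) :
  linear L -> L (\sw_(u, v <- t) f u v) = \sw_(u, v <- t) L (f u v).
Proof.
move=> lL; pose F : {linear X -> Y} :=
  HB.pack L (GRing.isLinear.Build _ _ _ _ _ lL).
exact: (linear_sum F).
Qed.

Lemma tsum3_lin U V W X Y (L : X -> Y) (t : U \ox V \ox W)
    (f : U -> V -> W -> X) :
  linear L -> L (\sw_(u, v, w <- t) f u v w) = \sw_(u, v, w <- t) L (f u v w).
Proof.
by move=> lL; rewrite /tsum3 tsum_lin //; apply: eq_tsum => s w; apply: tsum_lin.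
Qed.

Lemma eq_tsum3 U V W (X : nmodType) (t : U \ox V \ox W)
    (f g : U -> V -> W -> X) :
  (forall u v w, f u v w = g u v w) -> tsum3 t f = tsum3 t g.
Proof. by move=> fg; apply: eq_tsum => s w; apply: eq_tsum => u v. Qed.

Lemma tsumC U V U' V' (X : nmodType) (s : U \ox V) (t : U' \ox V')
    (f : U -> V -> U' -> V' -> X) :
  \sw_(a, b <- s) \sw_(c, d <- t) f a b c d
    = \sw_(c, d <- t) \sw_(a, b <- s) f a b c d.
Proof. exact: exchange_big. Qed.

Lemma tsum_tsum3C U V U' V' W' (X : nmodType) (s : U \ox V)
    (t : U' \ox V' \ox W') (f : U -> V -> U' -> V' -> W' -> X) :
  \sw_(a, b <- s) \sw_(c, d, e <- t) f a b c d e
    = \sw_(c, d, e <- t) \sw_(a, b <- s) f a b c d e.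
Proof. by rewrite /tsum3 tsumC; apply: eq_tsum => r e; apply: tsumC. Qed.

Lemma tsum3C U V W U' V' W' (X : nmodType) (s : U \ox V \ox W)
    (t : U' \ox V' \ox W') (f : U -> V -> W -> U' -> V' -> W' -> X) :
  \sw_(a, b, c <- s) \sw_(d, e, g <- t) f a b c d e g
    = \sw_(d, e, g <- t) \sw_(a, b, c <- s) f a b c d e g.
Proof.
rewrite [LHS]/tsum3 -[RHS]tsum_tsum3C; apply: eq_tsum => r c.
exact: tsum_tsum3C.
Qed.

Lemma tmap_bilin U V X Y (f : U -> X) (g : V -> Y) :
  linear f -> linear g -> bilin (fun u v => f u \ox g v).
Proof.
by move=> lf lg; split=> [v|u] a x y; rewrite ?lf ?lg ?pure_linlE ?pure_linrE.
Qed.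

Lemma tmap_linear U V X Y (f : U -> X) (g : V -> Y) :
  linear f -> linear g -> linear (tmap f g).
Proof. by move=> lf lg; apply: tsum_linear (tmap_bilin lf lg). Qed.

Lemma tmap_pure U V X Y (f : U -> X) (g : V -> Y) u v :
  linear f -> linear g -> tmap f g (u \ox v) = f u \ox g v.
Proof. by move=> lf lg; apply: tsum_pure (tmap_bilin lf lg). Qed.

End SweedlerSums.

(** * Evaluation of the leg in [M'] or in [M] *)

Section DualLegs.
Variables (k : fieldType) (M : vectType k).
Local Notation M' := 'Hom(M, k^o).

Definition evall (W : lmodType k) (m : M) (t : M' \ox W) : W :=
  \sw_(f, w <- t) (f m *: w).

Definition evalr (A : algType k) (f : M') (t : A \ox M) : A :=
  \sw_(a, m <- t) (f m *: a).

Lemma evall_linear (W : lmodType k) m : linear (@evall W m).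
Proof. exact: tsum_linear (eval_bilin W m). Qed.

Lemma evall_pure (W : lmodType k) m (f : M') (w : W) :
  evall m (f \ox w) = f m *: w.
Proof. exact: tsum_pure (eval_bilin W m). Qed.

Lemma evalr_linear (A : algType k) f : linear (@evalr A f).
Proof. exact: tsum_linear (coact_eval_bilin A f). Qed.

Lemma evalr_pure (A : algType k) f (a : A) (m : M) :
  evalr f (a \ox m) = f m *: a.
Proof. exact: tsum_pure (coact_eval_bilin A f). Qed.

(** Triple tensors are left-associated, so the [M']-leg lies inside the first factor [M' \ox V]. *)
Definition evall2 (V W : lmodType k) (m : M) : M' \ox V \ox W -> V \ox W :=
  tmap (evall m) id.

Lemma evall2_linear (V W : lmodType k) m : linear (@evall2 V W m).
Proof. exact: tmap_linear (@evall_linear V m) (@linear_id _ W). Qed.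

Lemma evall2_pure (V W : lmodType k) m (f : M') (v : V) (w : W) :
  evall2 m (f \ox v \ox w) = (f m : k) *: (v \ox w).
Proof.
rewrite /evall2 tmap_pure //; last exact: evall_linear.
by rewrite evall_pure pureZl.
Qed.

(** Finite dimension enters here: the values at the basis vectors [vb i], tensored with the dual
    basis [cvb i] and summed, give the tensor back. *)
Lemma evall2_inj (V W : lmodType k) (s t : M' \ox V \ox W) :
  (forall m, evall2 m s = evall2 m t) -> s = t.
Proof.
move=> st.
pose rebuild (r : M' \ox V \ox W) : M' \ox V \ox W :=
  \sum_i tmap (pure (cvb i)) id (evall2 (vb i) r).
have rebuildE : id =1 rebuild.
  (* By linearity it suffices to treat [r \ox w] with [r] in [M' \ox V], where the two-leg expansion
     [dual_tensorE] applies to [r]. *)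
  apply: tensor_ext => [//||r w]; rewrite /rebuild.
    apply: linear_sum_fun => i.
    apply: linear_comp (tmap_linear _ _) (@evall2_linear _ _ _) => //.
    exact: pure_linr.
  rewrite [r in LHS]dual_tensorE pure_suml; apply: eq_bigr => i _.
  rewrite /evall2 tmap_pure //; last exact: evall_linear.
  by rewrite tmap_pure //; apply: pure_linr.
rewrite [s]rebuildE [t]rebuildE /rebuild.
by apply: eq_bigr => i _; rewrite st.
Qed.

End DualLegs.

(** * The dual action, the dual coaction and the transposed operator *)

Section DualYetterDrinfeld.
Variables (k : fieldType) (H : algType k) (M : vectType k).
Variable coact : {linear M -> (H \ox M)%type}.
Local Notation M' := 'Hom(M, k^o).
Local Notation rho := (dual_coact coact).

(** The image under [G] of the identity that determines [rho]. It trades [rho] for [coact] when the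
    [H]-leg occurs inside a larger linear expression. *)
Lemma dual_coact_lin (X : lmodType k) (G : H -> X) (f : M') (m : M) :
  linear G ->
  \sw_(f0, a <- rho f) (f0 m *: G a) = \sw_(a, m0 <- coact m) (f m0 *: G a).
Proof.
move=> lG; have lZ c a : G (c *: a) = c *: G a.
  pose F : {linear H -> X} := HB.pack G (GRing.isLinear.Build _ _ _ _ _ lG).
  by rewrite -[LHS]/(F _) linearZ.
have := congr1 G (dual_coactP coact f m); rewrite !(tsum_lin _ _ lG).
by under eq_tsum do rewrite lZ; under [RHS]eq_tsum do rewrite lZ.
Qed.

Section Action.
Variable act : M -> H -> M.
Hypothesis act_mod : is_right_module act.

Let act_linl h : linear (act^~ h).
Proof. by have [[]] := act_mod. Qed.

Let act_linr m : linear (act m).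
Proof. by have [[]] := act_mod. Qed.

(** Precomposition reverses the order of composition, which turns a right action into a left one. *)
Lemma dual_is_left_module : is_left_module (dual_act act).
Proof.
split.
- split=> [f|h] a x y; apply/lfunP => m;
    rewrite add_lfunE scale_lfunE !dual_actE //.
    by rewrite act_linr linearP.
  by rewrite add_lfunE scale_lfunE.
- by move=> f; apply/lfunP => m; rewrite dual_actE // (ract1 act_mod).
- by move=> g h f; apply/lfunP => m; rewrite !dual_actE // (ractM act_mod).
Qed.

Lemma rl_R_pure m n :
  rl_R act coact (m \ox n) = \sw_(a, n0 <- coact n) (act m a \ox n0).
Proof.
rewrite /rl_R tsum_pure //; split=> [v|u] l x y.
  rewrite /tsum scaler_sumr -big_split; apply: eq_bigr => p _ /=.
  by rewrite act_linl pure_linlE.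
by rewrite linearP; apply: (tsum_linear (tmap_bilin (act_linr u) (@linear_id _ M))).
Qed.

(** By [dual_tensorK] it suffices to compare values on pairs of basis vectors. On [m \ox n] the left
    side pairs [g0] with [n], and trading [rho g] for [coact n] gives the right side. *)
Lemma lr_R_dual : lr_R (dual_act act) rho =1 transpose (rl_R act coact).
Proof.
move=> t; rewrite -[LHS]dual_tensorK /transpose /dual_tensor_inv.
apply: eq_bigr => i _; apply: eq_bigr => j _; congr (_ *: _).
move: (vb i) (vb j) => m n /=.
rewrite rl_R_pure /lr_R.
rewrite (tsum_lin _ _ (dual_tensor_linearl (m \ox n))) [RHS]/dual_tensor.
apply: eq_tsum => f g.
rewrite (tsum_lin _ _ (dual_tensor_linearl (m \ox n))).
rewrite (tsum_lin _ _ (tsum_linear (dual_tensor_bilin1 f g))).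
have lG : linear (fun a => f (act m a)) by move=> l x y; rewrite act_linr linearP.
transitivity (\sw_(g0, a <- rho g) (g0 n *: f (act m a))).
  by apply: eq_tsum => g0 a; rewrite dual_tensor_pure dual_actE // [RHS]mulrC.
rewrite dual_coact_lin //; apply: eq_tsum => a n0.
by rewrite (tsum_pure _ _ (dual_tensor_bilin1 f g)); apply: mulrC.
Qed.

End Action.

(** * The left-right Yetter-Drinfeld axioms for the dual *)

Variables (Q : quasi_bialgebra H) (act : M -> H -> M).
Hypothesis M_YD : is_rl_YD Q act coact.

Let act_linl h : linear (act^~ h).
Proof. by have [[[]]] := M_YD. Qed.

Lemma dual_coassoc n :
  \sw_(x1, x2, x3 <- PhiV Q)
  \sw_(n0, a <- rho n)
  \sw_(p0, b <- rho (dual_act act x2 n0))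
    (p0 \ox (b * x1) \ox (x3 * a))
  =
  \sw_(x1, x2, x3 <- PhiV Q)
  \sw_(y1, y2, y3 <- PhiV Q)
  \sw_(p0, a <- rho (dual_act act y3 n))
  \sw_(a1, a2 <- Delta Q a)
    (dual_act act x1 p0 \ox (x2 * a1 * y1) \ox (x3 * a2 * y2)).
Proof.
have mulP (u v x y : H) :
    bilin (fun a b => (u * a * v) \ox (x * b * y)).
  by apply: tmap_bilin => c z w;
    rewrite mulrDr mulrDl -scalerAr -scalerAl.
apply: evall2_inj => m.
have ll := @evall2_linear k M H H m.
have lr := @evalr_linear k M (H \ox H)%type n.
transitivity (evalr n (\sw_(x1, x2, x3 <- PhiV Q)
    \sw_(a, m0 <- coact m) \sw_(b, n0 <- coact (act m0 x2))
      ((a * x1) \ox (x3 * b) \ox n0))).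
  rewrite (tsum3_lin _ _ ll) (tsum3_lin _ _ lr); apply: eq_tsum3 => x1 x2 x3.
  (* The inner dual coaction is traded first, at [m]. The sum over [coact m] is then independent of
     [n0] and [a], so it can be moved outside and the outer coaction traded at [act m0 x2]. *)
  transitivity (\sw_(n0, a <- rho n) \sw_(b, m0 <- coact m)
      ((n0 (act m0 x2) : k) *: ((b * x1) \ox (x3 * a)))).
    rewrite (tsum_lin _ _ ll); apply: eq_tsum => n0 a.
    rewrite (tsum_lin _ _ ll); under eq_tsum do rewrite evall2_pure.
    rewrite dual_coact_lin => [|c z w]; last first.
      by rewrite mulrDl -scalerAl pure_linlE.
    by apply: eq_tsum => b m0; rewrite dual_actE.
  rewrite tsumC (tsum_lin _ _ lr); apply: eq_tsum => b m0.
  have lG : linear (fun a => (b * x1) \ox (x3 * a)).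
    by move=> c z w; rewrite mulrDr -scalerAr pure_linrE.
  rewrite (tsum_lin _ _ lr) (dual_coact_lin _ _ lG).
  by apply: eq_tsum => a q0; rewrite evalr_pure.
(* The copies [y] and [x] of the right-left axiom play the roles of [x] and [y] in the left-right
   one, hence the exchange. *)
rewrite (rl_YD_coassoc M_YD) tsum3C (tsum3_lin _ _ ll) (tsum3_lin _ _ lr).
apply: eq_tsum3 => x1 x2 x3.
rewrite (tsum3_lin _ _ ll) (tsum3_lin _ _ lr); apply: eq_tsum3 => y1 y2 y3.
(* [G] gathers everything that depends on the [H]-leg [a]; it is linear because [Delta Q] is, so
   [dual_coact_lin] applies to it. *)
pose G a : (H \ox H)%type := \sw_(a1, a2 <- Delta Q a) ((x2 * a1 * y1) \ox (x3 * a2 * y2)).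
have lG : linear G.
  apply: (@linear_comp _ _ _ _ (fun t => \sw_(a1, a2 <- t) _)).
    exact: tsum_linear (mulP x2 y1 x3 y2).
  exact: linearP.
have GZ c (a : H) : c *: G a = \sw_(a1, a2 <- Delta Q a)
    (c *: ((x2 * a1 * y1) \ox (x3 * a2 * y2))).
  by apply: tsum_lin => b u v; rewrite scalerDr !scalerA mulrC.
transitivity (\sw_(a, m0 <- coact (act m x1)) ((n (act m0 y3) : k) *: G a)).
  rewrite (tsum_lin _ _ lr); apply: eq_tsum => a m0.
  by rewrite (tsum_lin _ _ lr) GZ; apply: eq_tsum => a1 a2; rewrite evalr_pure.
transitivity (\sw_(p0, a <- rho (dual_act act y3 n)) ((p0 (act m x1) : k) *: G a)).
  by rewrite (dual_coact_lin _ _ lG); apply: eq_tsum => a m0; rewrite dual_actE.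
rewrite (tsum_lin _ _ ll); apply: eq_tsum => p0 a.
rewrite (tsum_lin _ _ ll) GZ; apply: eq_tsum => a1 a2.
by rewrite evall2_pure dual_actE.
Qed.

(** At each [m] this is [n] applied to the counit axiom for [m], with [eps Q] as the linear map in
    [dual_coact_lin]. *)
Lemma dual_counit n : \sw_(n0, a <- rho n) (eps Q a *: n0) = n.
Proof.
apply/lfunP => m.
have lev : linear (fun f : M' => f m) by move=> c f g; rewrite add_lfunE scale_lfunE.
rewrite (tsum_lin _ _ lev) -[in RHS](rl_YD_counit M_YD m).
rewrite (tsum_lin _ _ (linearP n)).
have le : linear (eps Q) by exact: linearP.
transitivity (\sw_(n0, a <- rho n) (n0 m *: eps Q a)).
  by apply: eq_tsum => n0 a; rewrite scale_lfunE [RHS]mulrC.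
rewrite dual_coact_lin //; apply: eq_tsum => a m0.
by rewrite linearZ [LHS]mulrC.
Qed.

(** Dualizing exchanges the two sides: evaluated at [m], the left side is the image under [n] of the
    right side of the compatibility axiom for [m], and conversely. *)
Lemma dual_compat n h :
  \sw_(h1, h2 <- Delta Q h) \sw_(n0, a <- rho n)
    (dual_act act h1 n0 \ox (h2 * a))
  =
  \sw_(h1, h2 <- Delta Q h) \sw_(p0, a <- rho (dual_act act h2 n))
    (p0 \ox (a * h1)).
Proof.
apply: dual_tensor_eq => m; rewrite -!/(evall m _).
have ll := @evall_linear k M H m; have lr := @evalr_linear k M H n.
transitivity (evalr n (\sw_(h1, h2 <- Delta Q h)
    \sw_(a, n0 <- coact (act m h1)) ((h2 * a) \ox n0))).
  rewrite (tsum_lin _ _ ll) (tsum_lin _ _ lr); apply: eq_tsum => h1 h2.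
  rewrite (tsum_lin _ _ ll) (tsum_lin _ _ lr).
  transitivity (\sw_(n0, a <- rho n) (n0 (act m h1) *: (h2 * a))).
    by apply: eq_tsum => n0 a; rewrite evall_pure dual_actE.
  rewrite dual_coact_lin => [|c z w]; last by rewrite mulrDr -scalerAr.
  by apply: eq_tsum => a m0; rewrite evalr_pure.
rewrite -(rl_YD_compat M_YD) (tsum_lin _ _ ll) (tsum_lin _ _ lr).
apply: eq_tsum => h1 h2; rewrite (tsum_lin _ _ ll) (tsum_lin _ _ lr).
under [RHS]eq_tsum do rewrite evall_pure.
rewrite dual_coact_lin => [|c z w]; last by rewrite mulrDl -scalerAl.
by apply: eq_tsum => a m0; rewrite evalr_pure dual_actE.
Qed.

End DualYetterDrinfeld.

Theorem proposition3p5 (k : fieldType) (H : algType k) (Q : quasi_bialgebra H)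
    (M : vectType k) (act : M -> H -> M)
    (coact : {linear M -> (H \ox M)%type})
    (M_YD : is_rl_YD Q act coact) :
  is_lr_YD Q (dual_act act) (dual_coact coact) /\
  lr_R (dual_act act) (dual_coact coact) =1 transpose (rl_R act coact).
Proof.
have act_mod := rl_YD_module M_YD.
split; last exact: lr_R_dual.
split; [exact: dual_is_left_module | exact: dual_coassoc | exact: dual_counit M_YD |].
exact: dual_compat.
Qed.
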